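(* Let $L$ be a lattice. Then the set of differential operators of weight $0$ (derivations) on $L$ equals the set of differential operators of weight $-1$ on $L$; that is, $\mathrm{DO}(L)=\mathrm{DW}_{-1}(L)$.
   Context: Let $(L,\vee,\wedge)$ be a lattice. An operator on $L$ is just a map $d:L\to L$ (no linearity or monotonicity is imposed). A derivation (differential operator of weight $0$) is an operator $d$ with $d(x\wedge y)=(d(x)\wedge y)\vee(x\wedge d(y))$ for all $x,y\in L$; the set of these is $\mathrm{DO}(L)$. A differential operator of weight $-1$ is an operator $d$ with $d(x\wedge y)\vee(d(x)\wedge d(y))=(d(x)\wedge y)\vee(x\wedge d(y))$ for all $x,y\in L$; the set of these is $\mathrm{DW}_{-1}(L)$. *)

(* Defs.v *)
From mathcomp Require Import all_boot all_order.
From mathcomp Require Import boolp classical_sets.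

Set Implicit Arguments.
Unset Strict Implicit.
Unset Printing Implicit Defensive.

Local Open Scope classical_set_scope.

Definition DO (disp : Order.disp_t) (L : latticeType disp) : set (L -> L) :=
  [set d | forall x y : L,
    d (x `&` y)%O = ((d x `&` y) `|` (x `&` d y))%O].

Definition DW_neg1 (disp : Order.disp_t) (L : latticeType disp) :
    set (L -> L) :=
  [set d | forall x y : L,
    (d (x `&` y) `|` (d x `&` d y))%O = ((d x `&` y) `|` (x `&` d y))%O].

Arguments DO {disp} L.
Arguments DW_neg1 {disp} L.

(* Main.v *)
Require Import Defs.
From mathcomp Require Import all_boot all_order.
From mathcomp Require Import boolp classical_sets.

Import Order.LTheory.
Local Open Scope order_scope.

(** The two defining identities differ only by the extra joinand [d x `&` d y]
    on the left, so they coincide as soon as this joinand is absorbed by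
    [d (x `&` y)]. Both kinds of operators are contracting, [d x <= x] (take
    [x = y] in the identity), so [d x `&` d y <= d x `&` y], and it suffices
    that [d x `&` y <= d (x `&` y)]. For a derivation this is part of its
    identity. In weight [-1] it comes from the identity at a comparable pair
    [z <= x]: there [x `&` d z] and the joinand [d z `&` d x] both reduce to
    terms below [d z], leaving [d z = (d x `&` z) `|` d z]; then take
    [z = x `&` y]. *)

Lemma DO_contract (disp : Order.disp_t) (L : latticeType disp) (d : L -> L) :
  DO L d -> forall x, d x <= x.
Proof. by move=> dP x; move: (dP x x); rewrite meetxx => ->; rewrite leUx leIr leIl. Qed.

Lemma DW_neg1_contract (disp : Order.disp_t) (L : latticeType disp)
    (d : L -> L) :
  DW_neg1 L d -> forall x, d x <= x.
Proof.
move=> dP x; move: (dP x x); rewrite !meetxx joinxx => ->.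
by rewrite leUx leIr leIl.
Qed.

(** Once [d x `&` z <= d z] is known for [z <= x], it extends to arbitrary [y]
    through [z = x `&` y], because contraction gives
    [d x `&` (x `&` y) = d x `&` y]. *)
Lemma DW_neg1_meet_le (disp : Order.disp_t) (L : latticeType disp)
    (d : L -> L) :
  DW_neg1 L d -> forall x y, d x `&` y <= d (x `&` y).
Proof.
move=> dP x y; have dle := DW_neg1_contract disp L d dP.
have le_zx : x `&` y <= x by exact: leIl.
have dz_le : d (x `&` y) <= x := le_trans (dle _) le_zx.
move: (dP x (x `&` y)); rewrite (meet_r le_zx) (meet_r dz_le).
rewrite (join_l (leIr _ _)) meetA (meet_l (dle x)) => ->.
exact: leUl.
Qed.

(** The absorption that makes the two identities equivalent. *)
Lemma meet_image_absorb (disp : Order.disp_t) (L : latticeType disp)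
    (d : L -> L) (x y : L) :
  (forall z, d z <= z) -> d x `&` y <= d (x `&` y) ->
  d (x `&` y) `|` (d x `&` d y) = d (x `&` y).
Proof.
move=> dle le_d; apply: join_l; apply: le_trans le_d.
by rewrite leI2.
Qed.

Theorem theorem2p3 (disp : Order.disp_t) (L : latticeType disp) :
  DO L = DW_neg1 L.
Proof.
apply/seteqP; split=> d dP x y.
- rewrite meet_image_absorb ?dP //; first exact: DO_contract.
  exact: leUl.
- rewrite -dP meet_image_absorb //; first exact: DW_neg1_contract.
  exact: DW_neg1_meet_le.
Qed.
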